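(* Let $G$ be a connected three-dimensional real Lie group with Lie algebra $\mathfrak{g}$. For any choice of orientation and left-invariant Riemannian metric on $G$, the following holds (where ''$\mathfrak g=\mathrm{Bian}(\cdot)$'' means that $\mathfrak g$ is isomorphic to the named Lie algebra of Bianchi's list): (1) If $\mathfrak{g} = \mathrm{Bian}(\mathrm{I})$, then every left-invariant metric on $G$ carries a (complex) two-dimensional space of invariant generalised Killing spinors with one eigenvalue (in fact, the spinors are parallel). (2) If $\mathfrak{g} = \mathrm{Bian}(\mathrm{II})$, then every left-invariant metric on $G$ carries a two-dimensional space of invariant generalised Killing spinors with two distinct eigenvalues. (3) If $\mathfrak{g} = \mathrm{Bian}(\mathrm{III})$, $\mathrm{Bian}(\mathrm{IV})$, $\mathrm{Bian}(\mathrm{V})$, $\mathrm{Bian}(\mathrm{VI}_{x})$ for some $0 < |x| < 1$, or $\mathrm{Bian}(\mathrm{VII}_{y})$ for some $y > 0$, then no left-invariant metric on $G$ carries non-trivial (i.e. non-zero) invariant generalised Killing spinors. (4) If $\mathfrak{g} = \mathrm{Bian}(\mathrm{VI}_{-1})$, then every left-invariant metric on $G$ carries a two-dimensional space of invariant generalised Killing spinors with three distinct eigenvalues. (5) If $\mathfrak{g} = \mathrm{Bian}(\mathrm{VII}_0)$, $\mathrm{Bian}(\mathrm{VIII})$ or $\mathrm{Bian}(\mathrm{IX})$, then every left-invariant metric on $G$ carries a two-dimensional space of invariant generalised Killing spinors. Moreover, the set of left-invariant metrics for which the number of distinct eigenvalues of these spinors is strictly less than $3$ has measure zero in the set of all left-invariant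 metrics on $G$.
   Context: Spinors. Let $G$ be a connected three-dimensional Lie group with an orientation and a left-invariant Riemannian metric $g$, corresponding to an inner product $B$ on the Lie algebra $\mathfrak g$. Fix a positively oriented $B$-orthonormal basis $(e_1,e_2,e_3)$ of $\mathfrak g$, identified with left-invariant vector fields. The spin structure used is the $G$-invariant one, i.e. the trivial one determined by the global left-invariant orthonormal frame. The spinor bundle is $G\times\Sigma$, where $\Sigma=\mathrm{span}_{\mathbb C}\{1,y_1\}\cong\mathbb C^2$, with Clifford multiplication $$e_1\cdot 1=i\,1,\quad e_1\cdot y_1=-i\,y_1,\quad e_2\cdot 1=i\,y_1,\quad e_2\cdot y_1=i\,1,\quad e_3\cdot 1=y_1,\quad e_3\cdot y_1=-1$$ (so $v\cdot v\cdot\psi=-B(v,v)\psi$). A spinor is a smooth map $\psi:G\to\Sigma$; it is invariant if it is constant, so invariant spinors are identified with elements of $\Sigma$. The spin connection $\widetilde\nabla^g$ is the lift of the Levi-Civita connection $\nabla^g$; for an invariant spinor $\psi\in\Sigma$ and $X\in\mathfrak g$, $\widetilde\nabla^g_X\psi=\frac12\sum_{i<j}g(\nabla^g_Xe_i,e_j)\,e_i\cdot e_j\cdot\psi$. Generalised Killing spinors. A spinor $\psi$ is generalised Killing if there is a $g$-symmetric endomorphism field $A$ of $TG$ with $\widetilde\nabla^g_X\psi=A(X)\cdot\psi$ for every vector field $X$. It is parallel if $A=0$ works. A (non-zero) generalised Killing spinor is said to have $r$ distinct eigenvalues if $A$ has $r$ distinct eigenvalues. ''The metric carries a two-dimensional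 space of invariant generalised Killing spinors'' means that the set of invariant generalised Killing spinors is a complex vector space of dimension 2. Measure. The set of left-invariant metrics on $G$ is identified with the set of inner products on $\mathfrak g$, an open subset of the six-dimensional real vector space of symmetric bilinear forms on $\mathfrak g$; measure zero is with respect to Lebesgue measure there. Bianchi's list. Each algebra has a basis $(f_1,f_2,f_3)$ with the following brackets (unlisted brackets of basis elements, up to antisymmetry, are zero): - $\mathrm{Bian}(\mathrm I)$: abelian. - $\mathrm{Bian}(\mathrm{II})$: $[f_2,f_3]=f_1$. - $\mathrm{Bian}(\mathrm{III})$: $[f_1,f_2]=f_1$. - $\mathrm{Bian}(\mathrm{IV})$: $[f_1,f_3]=f_1$, $[f_2,f_3]=f_1+f_2$. - $\mathrm{Bian}(\mathrm{V})$: $[f_1,f_3]=f_1$, $[f_2,f_3]=f_2$. - $\mathrm{Bian}(\mathrm{VI}_x)$, $-1\le x<1$, $x\ne0$: $[f_1,f_3]=f_1$, $[f_2,f_3]=xf_2$. - $\mathrm{Bian}(\mathrm{VII}_y)$, $y\ge0$: $[f_1,f_3]=yf_1-f_2$, $[f_2,f_3]=f_1+yf_2$. - $\mathrm{Bian}(\mathrm{VIII})$: $[f_1,f_2]=f_1$, $[f_1,f_3]=2f_2$, $[f_2,f_3]=f_3$. - $\mathrm{Bian}(\mathrm{IX})$: $[f_1,f_2]=f_3$, $[f_1,f_3]=-f_2$, $[f_2,f_3]=f_1$. *)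

(* Defs.v *)
From HB Require Import structures.
From mathcomp Require Import all_boot all_order all_algebra.
From mathcomp Require Import complex.
From mathcomp Require Import all_classical all_reals all_analysis.

Set Implicit Arguments.
Unset Strict Implicit.
Unset Printing Implicit Defensive.

Import Order.TTheory GRing.Theory Num.Theory.
Import numFieldNormedType.Exports.

Local Open Scope classical_set_scope.
Local Open Scope ring_scope.

(** * Three-dimensional Lie groups *)

Definition iter_derive (R : realType) (V W : normedModType R) (f : V -> W)
    (vs : seq V) : V -> W :=
  foldr (fun v h => fun x => 'D_v h x) f vs.

(* For D open this is C^oo on D: every iterated directional derivative exists
   and is itself (Frechet) differentiable at each point of D. *)
Definition smooth_on (R : realType) (V W : normedModType R) (D : set V)
    (f : V -> W) : Prop :=
  forall (vs : seq V) (x : V), D x -> differentiable (iter_derive f vs) x.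

#[short(type="topGroupType")]
HB.structure Definition TopGroup := {G of Group G & Topological G}.

(* [bwd] is the inverse of [fwd : dom -> fwd @` dom], extended arbitrarily. *)
Record chart (R : realType) (G : Type) := Chart {
  dom : set G;
  fwd : G -> 'rV[R]_3;
  bwd : 'rV[R]_3 -> G
}.

Definition cod (R : realType) (G : Type) (c : chart R G) : set 'rV[R]_3 :=
  fwd c @` dom c.

Record is_chart (R : realType) (G : topologicalType) (c : chart R G) : Prop := {
  dom_open : open (dom c);
  cod_open : open (cod c);
  fwdK : forall p, dom c p -> bwd c (fwd c p) = p;
  fwd_continuous : {within dom c, continuous (fwd c)};
  bwd_continuous : {within cod c, continuous (bwd c)}
}.

Record is_lie_group (R : realType) (G : topGroupType)
    (atlas : set (chart R G)) : Prop := {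
  lie_hausdorff : hausdorff_space G;
  lie_second_countable : @second_countable G;
  lie_chart : forall c, atlas c -> is_chart c;
  lie_cover : forall p : G, exists2 c, atlas c & dom c p;
  lie_compatible : forall c c', atlas c -> atlas c' ->
    smooth_on (fwd c @` (dom c `&` dom c')) (fwd c' \o bwd c);
  lie_mul_continuous : continuous (fun pq : G * G => (pq.1 * pq.2)%g);
  lie_inv_continuous : continuous (fun p : G => (p^-1)%g);
  lie_mul_smooth : forall c1 c2 c3, atlas c1 -> atlas c2 -> atlas c3 ->
    smooth_on
      [set xy : 'rV[R]_3 * 'rV[R]_3 |
        [/\ cod c1 xy.1, cod c2 xy.2 & dom c3 (bwd c1 xy.1 * bwd c2 xy.2)%g]]
      (fun xy => fwd c3 (bwd c1 xy.1 * bwd c2 xy.2)%g);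
  lie_inv_smooth : forall c1 c2, atlas c1 -> atlas c2 ->
    smooth_on [set x | cod c1 x /\ dom c2 ((bwd c1 x)^-1)%g]
      (fun x => fwd c2 ((bwd c1 x)^-1)%g)
}.

Definition smooth_map (R : realType) (G : topGroupType)
    (atlas : set (chart R G)) (W : normedModType R) (f : G -> W) : Prop :=
  forall c, atlas c -> smooth_on (cod c) (f \o bwd c).

(* The Lie algebra is the tangent space at 1, read in a chart [c] around 1, so
   that its elements are row vectors in R^3.  [left_field c v] is the coordinate
   expression, near [fwd c 1], of the left-invariant vector field with value [v]
   at 1: at the point of coordinates [x] it is the differential of the left
   translation by that point, applied to [v]. *)
Definition left_field (R : realType) (G : topGroupType) (c : chart R G)
    (v x : 'rV[R]_3) : 'rV[R]_3 :=
  'D_v (fun y => fwd c (bwd c x * bwd c y)%g) (fwd c 1%g).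

(* The Lie bracket D_V W - D_W V of vector fields on an open subset of R^3. *)
Definition field_bracket (R : realType) (V W : 'rV[R]_3 -> 'rV[R]_3)
    (x : 'rV[R]_3) : 'rV[R]_3 :=
  'D_(V x) W x - 'D_(W x) V x.

Definition lie_bracket (R : realType) (G : topGroupType) (c : chart R G)
    (v w : 'rV[R]_3) : 'rV[R]_3 :=
  field_bracket (left_field c v) (left_field c w) (fwd c 1%g).

(** * Bianchi's list *)

Definition vec3 (R : realType) (a b c : R) : 'rV[R]_3 :=
  \row_(j < 3) nth 0 [:: a; b; c] j.

(* The coordinates 0, 1, 2 are those along f_1, f_2, f_3; [b12], [b13], [b23]
   are the values of [f_1, f_2], [f_1, f_3], [f_2, f_3]. *)
Definition bracket_of (R : realType) (b12 b13 b23 : 'rV[R]_3)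
    (u v : 'rV[R]_3) : 'rV[R]_3 :=
  let d i j := u 0 (inord i) * v 0 (inord j) - u 0 (inord j) * v 0 (inord i) in
  d 0 1 *: b12 + d 0 2 *: b13 + d 1 2 *: b23.

Inductive bianchi (R : realType) :=
  | BianI | BianII | BianIII | BianIV | BianV
  | BianVI of R | BianVII of R | BianVIII | BianIX.
Arguments BianI {R}.
Arguments BianII {R}.
Arguments BianIII {R}.
Arguments BianIV {R}.
Arguments BianV {R}.
Arguments BianVIII {R}.
Arguments BianIX {R}.

Definition bianchi_bracket (R : realType) (b : bianchi R) :
    'rV[R]_3 -> 'rV[R]_3 -> 'rV[R]_3 :=
  match b with
  | BianI => bracket_of 0 0 0
  | BianII => bracket_of 0 0 (vec3 1 0 0)
  | BianIII => bracket_of (vec3 1 0 0) 0 0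
  | BianIV => bracket_of 0 (vec3 1 0 0) (vec3 1 1 0)
  | BianV => bracket_of 0 (vec3 1 0 0) (vec3 0 1 0)
  | BianVI x => bracket_of 0 (vec3 1 0 0) (vec3 0 x 0)
  | BianVII y => bracket_of 0 (vec3 y (-1) 0) (vec3 1 y 0)
  | BianVIII => bracket_of (vec3 1 0 0) (vec3 0 2 0) (vec3 0 0 1)
  | BianIX => bracket_of (vec3 0 0 1) (vec3 0 (-1) 0) (vec3 1 0 0)
  end.

Definition lie_isom (R : realType) (br br' : 'rV[R]_3 -> 'rV[R]_3 -> 'rV[R]_3) :
    Prop :=
  exists T : 'M[R]_3, T \in unitmx /\
    forall u v, br u v *m T = br' (u *m T) (v *m T).

(** * Left-invariant metrics *)

Definition bform (R : realType) (B : 'M[R]_3) (v w : 'rV[R]_3) : R :=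
  (v *m B *m w^T) 0 0.

Definition inner_product (R : realType) (B : 'M[R]_3) : Prop :=
  B^T = B /\ forall v : 'rV[R]_3, v != 0 -> 0 < bform B v v.

(* The rows of [E] are the vectors e_1, e_2, e_3.  As G is connected, an
   orientation of G amounts to one of the tangent space at 1, encoded by the
   sign of the determinant of its positive bases. *)
Definition oriented_frame (R : realType) (o : bool) (B E : 'M[R]_3) : Prop :=
  (forall i j, bform B (row i E) (row j E) = (i == j)%:R) /\
  0 < (-1) ^+ o * \det E.

(* The Levi-Civita connection maps left-invariant vector fields to
   left-invariant vector fields, and is given by its values on them; the inner
   product of two of them is constant, so its derivative drops out of the
   compatibility with the metric. *)
Definition is_levi_civita (R : realType)
    (br : 'rV[R]_3 -> 'rV[R]_3 -> 'rV[R]_3) (B : 'M[R]_3)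
    (nabla : 'rV[R]_3 -> 'rV[R]_3 -> 'rV[R]_3) : Prop :=
  [/\ forall X, linear (nabla X),
      forall Y, linear (nabla ^~ Y),
      forall X Y Z, bform B (nabla X Y) Z + bform B Y (nabla X Z) = 0
    & forall X Y, nabla X Y - nabla Y X = br X Y].

(* For a Lie bracket and an inner product there is exactly one such
   connection. *)
Definition levi_civita (R : realType)
    (br : 'rV[R]_3 -> 'rV[R]_3 -> 'rV[R]_3) (B : 'M[R]_3) :
    'rV[R]_3 -> 'rV[R]_3 -> 'rV[R]_3 :=
  xget (fun _ _ => 0) [set nabla | is_levi_civita br B nabla].

(* Lebesgue measure on R^6, carried to the symmetric matrices by their
   upper-triangular entries. *)
Definition sym_mx (R : realType) (b : R * (R * (R * (R * (R * R))))) : 'M[R]_3 :=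
  let: (b11, (b12, (b13, (b22, (b23, b33))))) := b in
  \matrix_(i < 3, j < 3) nth 0 (nth [::]
    [:: [:: b11; b12; b13]; [:: b12; b22; b23]; [:: b13; b23; b33]] i) j.

Definition null_metrics (R : realType) (S : set 'M[R]_3) : Prop :=
  let l := @lebesgue_measure R in
  (l \x (l \x (l \x (l \x (l \x l)))))%E.-negligible [set b | S (sym_mx b)].

(** * Invariant spinors *)

(* A column vector is a spinor in the basis (1, y_1) of Sigma. *)
Definition spinor (R : realType) := 'cV[R[i]]_2.

Definition mx22 (R : realType) (a b c d : R[i]) : 'M[R[i]]_2 :=
  \matrix_(i < 2, j < 2) nth 0 (nth [::] [:: [:: a; b]; [:: c; d]] i) j.

Definition clifford_gen (R : realType) (k : 'I_3) : 'M[R[i]]_2 :=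
  let I : R[i] := Complex 0 1 in
  nth 0 [:: mx22 I 0 0 (- I); mx22 0 I I 0; mx22 0 (-1) 1 0] k.

(* [v *m invmx E] is the row of coordinates of [v] in the frame [E]. *)
Definition clifford (R : realType) (E : 'M[R]_3) (v : 'rV[R]_3)
    (psi : spinor R) : spinor R :=
  \sum_(k < 3) Complex ((v *m invmx E) 0 k) 0 *: (clifford_gen R k *m psi).

Definition spin_nabla (R : realType)
    (br : 'rV[R]_3 -> 'rV[R]_3 -> 'rV[R]_3) (B E : 'M[R]_3) (X : 'rV[R]_3)
    (psi : spinor R) : spinor R :=
  2^-1 *: \sum_(i < 3) \sum_(j < 3 | (i < j)%N)
    Complex (bform B (levi_civita br B X (row i E)) (row j E)) 0 *:
      clifford E (row i E) (clifford E (row j E) psi).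

(** * Generalised Killing spinors *)

Definition parallel (R : realType)
    (br : 'rV[R]_3 -> 'rV[R]_3 -> 'rV[R]_3) (B E : 'M[R]_3)
    (psi : spinor R) : Prop :=
  forall X, spin_nabla br B E X psi = 0.

(* The tangent bundle of G is trivialised by left translations: vector fields
   are functions to R^3 and endomorphism fields are functions to the 3x3
   matrices, acting on row vectors from the right. *)
Definition gen_killing_with (R : realType) (G : topGroupType)
    (atlas : set (chart R G)) (br : 'rV[R]_3 -> 'rV[R]_3 -> 'rV[R]_3)
    (B E : 'M[R]_3) (A : G -> 'M[R]_3) (psi : spinor R) : Prop :=
  [/\ smooth_map atlas A,
      forall p v w, bform B (v *m A p) w = bform B v (w *m A p)
    & forall X : G -> 'rV[R]_3, smooth_map atlas X ->
        forall p, spin_nabla br B E (X p) psi = clifford E (X p *m A p) psi].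

Definition gen_killing (R : realType) (G : topGroupType)
    (atlas : set (chart R G)) (br : 'rV[R]_3 -> 'rV[R]_3 -> 'rV[R]_3)
    (B E : 'M[R]_3) (psi : spinor R) : Prop :=
  exists A, gen_killing_with atlas br B E A psi.

Definition num_eigenvalues (R : realType) (A : 'M[R]_3) (r : nat) : Prop :=
  exists s : seq R, [/\ uniq s, size s = r & forall a, (a \in s) = eigenvalue A a].

Definition gen_killing_eigenvalues (R : realType) (G : topGroupType)
    (atlas : set (chart R G)) (br : 'rV[R]_3 -> 'rV[R]_3 -> 'rV[R]_3)
    (B E : 'M[R]_3) (psi : spinor R) (r : nat) : Prop :=
  exists A, gen_killing_with atlas br B E A psi /\
    forall p, num_eigenvalues (A p) r.

Definition two_dim_gen_killing (R : realType) (G : topGroupType)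
    (atlas : set (chart R G)) (br : 'rV[R]_3 -> 'rV[R]_3 -> 'rV[R]_3)
    (B E : 'M[R]_3) : Prop :=
  exists U : {vspace spinor R}, \dim U = 2 /\
    forall psi : spinor R, psi \in U <-> gen_killing atlas br B E psi.

Definition two_dim_gen_killing_eigenvalues (R : realType) (G : topGroupType)
    (atlas : set (chart R G)) (br : 'rV[R]_3 -> 'rV[R]_3 -> 'rV[R]_3)
    (B E : 'M[R]_3) (r : nat) : Prop :=
  two_dim_gen_killing atlas br B E /\
  forall psi : spinor R, psi != 0 -> gen_killing atlas br B E psi ->
    gen_killing_eigenvalues atlas br B E psi r.

(* Main.v *)
(** A three-dimensional Lie algebra is given by a matrix [N] with
    [[u, v] = (u x v) N].  In an orthonormal frame [N] becomes a matrix
    [S = c Q^T N Q], and Koszul's formula together with [e_1 e_2 = e_3],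
    [e_2 e_3 = e_1], [e_1 e_3 = - e_2] shows that the spin connection on invariant
    spinors is Clifford multiplication by [X M], where [M = (tr S / 2 - S^T) / 2].
    Clifford multiplication on a non-zero spinor is injective, so an invariant
    spinor is generalised Killing iff it is zero or [S] is symmetric (that is, [N]
    is symmetric: the algebra is unimodular), and then [A = M].  The eigenvalues
    of [M] are affine in those of [S]; for types II and VI_(-1) these are explicit
    because [S] is a multiple of [q^T q] or of [u^T v + v^T u].

    For the null set: if the symmetric matrix [S] has fewer than three eigenvalues,
    it is annihilated by a polynomial of degree at most two, hence so is [N B],
    which is similar to a multiple of [S].  Then [v], [v N B], [v (N B)^2] are
    linearly dependent for every [v]: their determinant is a polynomial in the
    entries of [B], not identically zero for a suitable [v], and its zero set is
    null by Fubini. *)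

Require Import Defs.
From HB Require Import structures.
From mathcomp Require Import all_boot all_order all_algebra.
From mathcomp Require Import complex.
From mathcomp Require Import all_classical all_reals all_analysis.
From mathcomp Require Import measurable_realfun.
From mathcomp Require Import ring lra.

Set Implicit Arguments.
Unset Strict Implicit.
Unset Printing Implicit Defensive.

Import Order.TTheory GRing.Theory Num.Theory.
Import numFieldNormedType.Exports.

Local Open Scope classical_set_scope.
Local Open Scope ring_scope.

(** * Structure matrices *)

Lemma sum3 (V : nmodType) (F : 'I_3 -> V) : \sum_(i < 3) F i = F 0 + F 1 + F 2.
Proof.
by rewrite !big_ord_recr big_ord0 /= add0r; congr (F _ + F _ + F _); apply: val_inj.
Qed.

Lemma ord3_ind (P : 'I_3 -> Prop) : P 0 -> P 1 -> P 2 -> forall i, P i.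
Proof.
move=> P0 P1 P2 [[|[|[|//]]] lt_i3].
- by rewrite (_ : Ordinal _ = 0) //; apply: val_inj.
- by rewrite (_ : Ordinal _ = 1) //; apply: val_inj.
- by rewrite (_ : Ordinal _ = 2) //; apply: val_inj.
Qed.

Lemma det3 (F : comNzRingType) (M : 'M[F]_3) :
  \det M = M 0 0 * (M 1 1 * M 2 2 - M 1 2 * M 2 1)
         - M 0 1 * (M 1 0 * M 2 2 - M 1 2 * M 2 0)
         + M 0 2 * (M 1 0 * M 2 1 - M 1 1 * M 2 0).
Proof.
rewrite (expand_det_row _ 0) sum3 /cofactor.
do 3![rewrite (expand_det_row _ (0 : 'I_2)) !big_ord_recl big_ord0 /cofactor
  !det_mx11 !mxE].
have l (i : 'I_3) (j : 'I_2) (k : 'I_3) :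
    nat_of_ord (lift i j) = nat_of_ord k -> lift i j = k.
  by move/val_inj.
have l2 (i j : 'I_2) (k : 'I_1) : nat_of_ord (lift i k) = nat_of_ord j -> lift i k = j.
  by move/val_inj.
rewrite ?(l2 0 1 0 erefl) ?(l2 1 0 0 erefl).
rewrite ?(l 0 0 1 erefl) ?(l 0 1 2 erefl).
rewrite ?(l 1 0 0 erefl) ?(l 1 1 2 erefl) ?(l 2 0 0 erefl) ?(l 2 1 1 erefl).
by rewrite /= !modn_small //= !addn1 !add0n expr0 expr1 sqrrN expr1n; ring.
Qed.

Definition cross (R : realType) (u v : 'rV[R]_3) : 'rV[R]_3 :=
  vec3 (u 0 1 * v 0 2 - u 0 2 * v 0 1) (u 0 2 * v 0 0 - u 0 0 * v 0 2)
       (u 0 0 * v 0 1 - u 0 1 * v 0 0).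
Arguments cross {R} u v.

Section Bracket.
Variable R : realType.
Implicit Types (u v w x y z : 'rV[R]_3) (A B E L M N P S T : 'M[R]_3).

Definition rows3 (a b c : 'rV[R]_3) : 'M[R]_3 :=
  \matrix_(i < 3, j < 3) nth 0 [:: a; b; c] i 0 j.

(** Triple product: the left side paired with [w] is the determinant of the rows [u *m P], [v *m P],
    [w *m P], that is, [\det P] times the determinant of the rows [u], [v], [w]. *)
Lemma crossM u v P : cross (u *m P) (v *m P) *m P^T = \det P *: cross u v.
Proof.
apply/rowP; apply: ord3_ind; rewrite !mxE !sum3 !mxE /= ?mxE ?sum3 ?mxE det3; ring.
Qed.

Lemma crossMV u v P : P \in unitmx ->
  cross (u *m P) (v *m P) = \det P *: (cross u v *m invmx P^T).
Proof.
move=> uP; have uPt : P^T \in unitmx by rewrite unitmx_tr.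
rewrite -[LHS](mulmxK uPt).
by rewrite crossM scalemxAl.
Qed.

(** The components of [cross u v] are [d 1 2], [- d 0 2] and [d 0 1], whence the order of the rows
    and the sign of the middle one. *)
Lemma bracket_ofE b12 b13 b23 u v :
  bracket_of b12 b13 b23 u v = cross u v *m rows3 b23 (- b13) b12.
Proof.
rewrite /bracket_of.
have -> : inord 0 = 0 :> 'I_3 by apply: val_inj; rewrite /= inordK.
have -> : inord 1 = 1 :> 'I_3 by apply: val_inj; rewrite /= inordK.
have -> : inord 2 = 2 :> 'I_3 by apply: val_inj; rewrite /= inordK.
apply/rowP=> j; rewrite !mxE !sum3 !mxE /= ?mxE; ring.
Qed.

Definition bianchi_mx (b : bianchi R) : 'M[R]_3 :=
  match b with
  | BianI => 0
  | BianII => rows3 (vec3 1 0 0) 0 0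
  | BianIII => rows3 0 0 (vec3 1 0 0)
  | BianIV => rows3 (vec3 1 1 0) (- vec3 1 0 0) 0
  | BianV => rows3 (vec3 0 1 0) (- vec3 1 0 0) 0
  | BianVI x => rows3 (vec3 0 x 0) (- vec3 1 0 0) 0
  | BianVII y => rows3 (vec3 1 y 0) (- vec3 y (-1) 0) 0
  | BianVIII => rows3 (vec3 0 0 1) (- vec3 0 2 0) (vec3 1 0 0)
  | BianIX => rows3 (vec3 1 0 0) (- vec3 0 (-1) 0) (vec3 0 0 1)
  end.

Lemma bianchi_bracketE b u v : bianchi_bracket b u v = cross u v *m bianchi_mx b.
Proof.
case: b => [||||| x | y ||] /=; rewrite bracket_ofE ?oppr0 //.
congr (_ *m _); apply/matrixP=> i j; rewrite !mxE.
by case: i => [[|[|[|]]]] //= _; rewrite mxE.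
Qed.

(* Structure matrices are tensor densities of weight one: this is the change of
   basis rule for the matrix [N] of [br u v = cross u v *m N]. *)
Lemma lie_isom_cross (br : 'rV[R]_3 -> 'rV[R]_3 -> 'rV[R]_3) N :
  lie_isom br (fun u v => cross u v *m N) ->
  exists2 T, T \in unitmx &
    forall u v, br u v = cross u v *m (\det T *: (invmx T^T *m N *m invmx T)).
Proof.
case=> T [uT isoT]; exists T => // u v.
rewrite -[LHS](mulmxK uT) isoT crossMV // -!scalemxAl -!scalemxAr.
by rewrite !mulmxA.
Qed.

Lemma lie_isom_bianchi (br : 'rV[R]_3 -> 'rV[R]_3 -> 'rV[R]_3) b :
  lie_isom br (bianchi_bracket b) ->
  exists2 T, T \in unitmx & forall u v,
    br u v = cross u v *m (\det T *: (invmx T^T *m bianchi_mx b *m invmx T)).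
Proof.
case=> T [uT isoT]; apply: lie_isom_cross; exists T; split=> // u v.
by rewrite isoT bianchi_bracketE.
Qed.

End Bracket.

(** * The Levi-Civita connection and Clifford multiplication *)

Section Koszul.
Variable R : realType.
Implicit Types (u v w x y z : 'rV[R]_3) (A B E L M N P S T : 'M[R]_3).
Implicit Type psi : spinor R.

(** The covariant derivative given by Koszul's formula in an orthonormal frame with bracket
    [cross u v *m S]. In the last two terms the transposes and the cyclic symmetry of the triple
    product free the test vector [w] of [koszul_rowE]. *)
Definition koszul_row S u v : 'rV[R]_3 :=
  2^-1 *: (cross u v *m S - cross (u *m S^T) v + cross u (v *m S^T)).

Lemma koszul_rowE S u v w :
  (koszul_row S u v *m w^T) 0 0 =
  2^-1 * ((cross u v *m S *m w^T) 0 0 - (cross v w *m S *m u^T) 0 0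
          + (cross w u *m S *m v^T) 0 0).
Proof.
rewrite /koszul_row -scalemxAl !mulmxDl mulNmx !mxE; congr (_ * _).
rewrite !(mxE, sum3) /= ?(mxE, sum3) /=; ring.
Qed.

Lemma cross_linearl v : linear (cross ^~ v).
Proof. by move=> a u w; apply/rowP; apply: ord3_ind; rewrite !mxE /=; ring. Qed.

Lemma cross_linearr u : linear (cross u).
Proof. by move=> a v w; apply/rowP; apply: ord3_ind; rewrite !mxE /=; ring. Qed.

Lemma koszul_row_linearl S v : linear (koszul_row S ^~ v).
Proof.
move=> a u w; rewrite /koszul_row.
rewrite !(mulmxDl, cross_linearl, =^~ scalemxAl).
move: (cross u v *m S) (cross w v *m S) (cross (u *m S^T) v) (cross (w *m S^T) v)
  (cross u (v *m S^T)) (cross w (v *m S^T)) => p1 p2 p3 p4 p5 p6.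
by apply/rowP=> i; rewrite !mxE; ring.
Qed.

Lemma koszul_row_linearr S u : linear (koszul_row S u).
Proof.
move=> a v w; rewrite /koszul_row.
rewrite !(mulmxDl, cross_linearr, =^~ scalemxAl).
move: (cross u v *m S) (cross u w *m S) (cross (u *m S^T) v) (cross (u *m S^T) w)
  (cross u (v *m S^T)) (cross u (w *m S^T)) => p1 p2 p3 p4 p5 p6.
by apply/rowP=> i; rewrite !mxE; ring.
Qed.

Lemma koszul_row_torsion S u v : koszul_row S u v - koszul_row S v u = cross u v *m S.
Proof.
by apply/rowP; apply: ord3_ind;
  rewrite !(mxE, sum3) /= ?(mxE, sum3) /=; field; rewrite ?pnatr_eq0.
Qed.

End Koszul.

(** * Clifford multiplication and the matrix of the spin connection *)

Section Spin.
Variable R : realType.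
Implicit Types (u v w x y z : 'rV[R]_3) (A B E L M N P S T : 'M[R]_3).
Implicit Type psi : spinor R.

Lemma cliffordE E x psi : E \in unitmx ->
  clifford E (x *m E) psi = \sum_(k < 3) (x 0 k)%:C%C *: (clifford_gen R k *m psi).
Proof. by move=> uE; rewrite /clifford mulmxK. Qed.

Lemma clifford_row E k psi : E \in unitmx ->
  clifford E (row k E) psi = clifford_gen R k *m psi.
Proof.
move=> uE; rewrite rowE cliffordE // (bigD1 k) //= big1 ?addr0 => [|i nik].
  by rewrite mxE !eqxx scale1r.
by rewrite mxE eqxx (negPf nik) scale0r.
Qed.

Lemma clifford_gen01 : clifford_gen R 0 *m clifford_gen R 1 = clifford_gen R 2.
Proof.
by apply/matrixP=> [[[|[|//]] ?] [[|[|//]] ?]];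
  rewrite !mxE !big_ord_recl big_ord0 !mxE /= addr0; simpc.
Qed.

Lemma clifford_gen02 : clifford_gen R 0 *m clifford_gen R 2 = - clifford_gen R 1.
Proof.
by apply/matrixP=> [[[|[|//]] ?] [[|[|//]] ?]];
  rewrite !mxE !big_ord_recl big_ord0 !mxE /= addr0; simpc.
Qed.

Lemma clifford_gen12 : clifford_gen R 1 *m clifford_gen R 2 = clifford_gen R 0.
Proof.
by apply/matrixP=> [[[|[|//]] ?] [[|[|//]] ?]];
  rewrite !mxE !big_ord_recl big_ord0 !mxE /= addr0; simpc.
Qed.

Lemma clifford_sqr x :
  let C := \sum_(k < 3) (x 0 k)%:C%C *: clifford_gen R k in
  C *m C = - (\sum_k x 0 k ^+ 2)%:C%C *: 1%:M.
Proof.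
rewrite /= !sum3 !rmorphD !rmorphXn /=.
have -> : clifford_gen R 0 = mx22 'i%C 0 0 (- 'i%C) by [].
have -> : clifford_gen R 1 = mx22 0 'i%C 'i%C 0 by [].
have -> : clifford_gen R 2 = mx22 0 (- 1) 1 0 by [].
have := sqr_i R; move: 'i%C (x 0 0)%:C%C (x 0 1)%:C%C (x 0 2)%:C%C => I a b c II.
by apply/matrixP=> [[[|[|//]] ?] [[|[|//]] ?]];
  rewrite !(mxE, big_ord_recl, big_ord0) /=; ring: II.
Qed.

(** By [clifford_sqr], multiplying twice by the vector scales [psi] by minus its squared norm, so
    this norm vanishes. *)
Lemma clifford_inj E x psi : E \in unitmx -> psi != 0 ->
  clifford E (x *m E) psi = 0 -> x = 0.
Proof.
move=> uE psi0; rewrite cliffordE // => cx0.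
have := clifford_sqr x; set C := \sum_k _ => /= sqC.
have Cpsi : C *m psi = 0.
  by rewrite mulmx_suml -[RHS]cx0; apply: eq_bigr => k _; rewrite -scalemxAl.
have : C *m C *m psi = 0 by rewrite -mulmxA Cpsi mulmx0.
rewrite sqC -scalemxAl mul1mx => /eqP; rewrite scaler_eq0 (negPf psi0) orbF oppr_eq0.
rewrite (_ : 0 = 0%:C%C) // (inj_eq (@complexI _)).
rewrite psumr_eq0 => [|i _]; last exact: sqr_ge0.
move=> /allP x0; apply/rowP=> k; rewrite mxE; apply/eqP.
by have := x0 k; rewrite mem_index_enum /= sqrf_eq0 => ->.
Qed.

Definition spin_mx S : 'M[R]_3 := 2^-1 *: ((\tr S / 2)%:M - S^T).

Lemma spin_mx_sym S : ((spin_mx S)^T == spin_mx S) = (S^T == S).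
Proof.
have h : (2 : R)^-1 != 0 by rewrite invr_eq0 pnatr_eq0.
rewrite /spin_mx linearZ /= (inj_eq (scalerI h)) linearB /= tr_scalar_mx trmxK.
by rewrite (inj_eq (addrI _)) eqr_opp eq_sym.
Qed.

(** The covariant derivative along [x] is a skew operator, hence a vector in dimension three:
    [G i j] is the signed component of twice [x *m spin_mx S] on the remaining axis. The factor 2
    cancels the 1/2 of the spin connection. *)
Lemma koszul_spin_mx S x :
  let e i : 'rV[R]_3 := delta_mx 0 i in
  let G i j := (koszul_row S x (e i) *m (e j)^T) 0 0 in
  [/\ G 0 1 = 2 * (x *m spin_mx S) 0 2, G 0 2 = - (2 * (x *m spin_mx S) 0 1)
    & G 1 2 = 2 * (x *m spin_mx S) 0 0].
Proof.
by split; rewrite koszul_rowE /spin_mx -scalemxAr /mxtrace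
  !(mxE, sum3) /= ?(mxE, sum3) /=; field; rewrite ?pnatr_eq0.
Qed.

End Spin.

Lemma frame_gram (R : realType) (o : bool) (B E : 'M[R]_3) :
  oriented_frame o B E -> E *m B *m E^T = 1%:M.
Proof.
case=> hE _; apply/matrixP=> i j; rewrite [RHS]mxE -hE /bform -row_mul tr_row.
rewrite [LHS]mxE [RHS]mxE; apply: eq_bigr => k _.
by rewrite [row _ _ _ _]mxE [col _ _ _ _]mxE.
Qed.

Lemma smooth_on_cst (R : realType) (V W : normedModType R) (D : set V) (a : W) :
  smooth_on D (fun=> a).
Proof.
have iter0 vs : iter_derive (fun _ : V => 0 : W) vs = (fun _ : V => 0 : W).
  by elim: vs => //= v vs ->; apply/funext => x; exact: derive_cst.
move=> vs x _.
suff [b ->] : exists b : W, iter_derive (fun _ : V => a) vs = (fun _ : V => b).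
  exact: differentiable_cst.
elim: vs => [|v vs [b /= ->]]; first by exists a.
by exists 0; apply/funext => y; exact: derive_cst.
Qed.

Lemma num_eigenvalues_map (R : realType) (M M' : 'M[R]_3) (f g : R -> R) r :
  cancel f g -> cancel g f -> (forall a, eigenvalue M a = eigenvalue M' (f a)) ->
  num_eigenvalues M r -> num_eigenvalues M' r.
Proof.
move=> fK gK fE [s [us <- sE]]; exists (map f s); split; last 1 first.
- by move=> b; rewrite -[b]gK mem_map ?sE ?fE //; exact: can_inj fK.
- by rewrite map_inj_uniq //; exact: can_inj fK.
- exact: size_map.
Qed.

(** * Connection, spinors and Killing endomorphism in an orthonormal frame *)

Section Frame.
Variables (R : realType) (br : 'rV[R]_3 -> 'rV[R]_3 -> 'rV[R]_3).
Variables (N B E : 'M[R]_3).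
Hypothesis brE : forall u v, br u v = cross u v *m N.
Hypothesis gramE : E *m B *m E^T = 1%:M.
Implicit Types (u v w x y z : 'rV[R]_3) (psi : spinor R).

(** The structure matrix of [br] in the basis formed by the rows of [E]; [br_frame] is its defining
    property. *)
Definition frame_mx : 'M[R]_3 := \det E *: (invmx E^T *m N *m invmx E).
Local Notation S := frame_mx.

Lemma frame_unit : E \in unitmx.
Proof.
have : E *m (B *m E^T) = 1%:M by rewrite mulmxA.
by case/mulmx1_unit.
Qed.
Local Notation uE := frame_unit.

Lemma bform_frame x y : bform B (x *m E) (y *m E) = (x *m y^T) 0 0.
Proof.
rewrite /bform trmx_mul !mulmxA -(mulmxA _ E) -mulmxA mulmxA -(mulmxA x).
by rewrite gramE mulmx1.
Qed.

Lemma bformC v w : bform B v w = bform B w v.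
Proof.
rewrite -(mulmxKV uE v) -(mulmxKV uE w) !bform_frame.
move: (v *m _) (w *m _) => {}v {}w.
by rewrite -[v in LHS]trmxK -trmx_mul [LHS]mxE.
Qed.

Lemma br_frame u v : br (u *m E) (v *m E) = cross u v *m S *m E.
Proof.
rewrite brE (crossMV _ _ uE) /S -scalemxAr -!scalemxAl -!mulmxA mulVmx ?uE //.
by rewrite mulmx1 scalemxAl.
Qed.

(** Vanishing torsion turns the three brackets of Koszul's formula into six covariant derivatives;
    skewness with respect to the metric makes four of them cancel and the other two agree. *)
Lemma is_levi_civita_koszul nabla x y z : is_levi_civita br B nabla ->
  bform B (nabla (x *m E) (y *m E)) (z *m E) = (koszul_row S x y *m z^T) 0 0.
Proof.
case=> _ _ compat torsion.
have brS u v w : (cross u v *m S *m w^T) 0 0 =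
    bform B (nabla (u *m E) (v *m E)) (w *m E)
    - bform B (nabla (v *m E) (u *m E)) (w *m E).
  by rewrite -bform_frame -br_frame -torsion /bform !mulmxBl mxE [X in _ + X]mxE.
have cmp u v w : bform B (nabla (u *m E) (v *m E)) (w *m E) =
    - bform B (nabla (u *m E) (w *m E)) (v *m E).
  by apply/eqP; rewrite -addr_eq0 [X in _ + X]bformC compat.
rewrite koszul_rowE !brS (cmp z x y) (cmp z y x) (cmp y z x) (cmp x z y); lra.
Qed.

(** Existence ensures that the choice made in [levi_civita] is a genuine connection and not the
    default value 0. *)
Lemma levi_civita_exists : is_levi_civita br B
  (fun X Y => koszul_row S (X *m invmx E) (Y *m invmx E) *m E).
Proof.
split=> [X a u v|Y a u v|X Y Z|X Y].
- by rewrite mulmxDl -scalemxAl koszul_row_linearr mulmxDl -scalemxAl.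
- by rewrite mulmxDl -scalemxAl koszul_row_linearl mulmxDl -scalemxAl.
- have K x y W : bform B (koszul_row S x y *m E) W =
      (koszul_row S x y *m (W *m invmx E)^T) 0 0 by rewrite -bform_frame mulmxKV ?uE.
  rewrite [X in _ + X]bformC !K !koszul_rowE.
  move: (X *m _) (Y *m _) (Z *m _) => x y z.
  have crossC u v : cross u v = - cross v u.
    by apply/rowP; apply: ord3_ind; rewrite !mxE /=; ring.
  by rewrite (crossC y x) (crossC z y) (crossC x z) !mulNmx !mxE; lra.
- by rewrite -mulmxBl koszul_row_torsion -br_frame !mulmxKV ?uE.
Qed.

Lemma levi_civitaE x y z :
  bform B (levi_civita br B (x *m E) (y *m E)) (z *m E) = (koszul_row S x y *m z^T) 0 0.
Proof.
apply: is_levi_civita_koszul; rewrite /levi_civita.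
by apply: xgetPex; exists (fun X Y => koszul_row S (X *m invmx E) (Y *m invmx E) *m E);
  exact: levi_civita_exists.
Qed.

(* The products of two Clifford generators are, up to sign, the third one, so
   the spin connection acts through Clifford multiplication by a vector. *)
Lemma spin_nablaE x psi :
  spin_nabla br B E (x *m E) psi = clifford E (x *m spin_mx S *m E) psi.
Proof.
rewrite cliffordE ?uE // /spin_nabla.
under eq_bigr => i _ do rewrite big_mkcond /=.
rewrite !sum3 /= !add0r !addr0.
rewrite !clifford_row ?uE // !mulmxA clifford_gen01 clifford_gen02 clifford_gen12.
rewrite !rowE !levi_civitaE.
have [-> -> ->] := koszul_spin_mx S x.
rewrite mulNmx !scalerDr !scalerN !scalerA.
have half (a : R) : 2^-1 * Complex (2 * a) 0 = a%:C%C :> R[i].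
  rewrite -[Complex _ _]/((2 * a)%:C%C) rmorphM /= rmorph_nat mulKf ?pnatr_eq0 //.
have halfN (a : R) : 2^-1 * Complex (- (2 * a)) 0 = - a%:C%C :> R[i].
  by rewrite -[Complex _ _]/((- (2 * a))%:C%C) rmorphN mulrN half.
rewrite !half halfN.
move: (_ *m psi) (_ *m psi) (_ *m psi) (_%:C)%C (_%:C)%C (_%:C)%C => p q r a b c.
by rewrite scaleNr opprK -addrA [RHS]addrC; congr (_ + _); exact: addrC.
Qed.

Definition killing_mx : 'M[R]_3 := invmx E *m spin_mx S *m E.

Lemma spin_nabla_killing X psi :
  spin_nabla br B E X psi = clifford E (X *m killing_mx) psi.
Proof. by rewrite -{1}(mulmxKV uE X) spin_nablaE /killing_mx !mulmxA. Qed.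

Lemma killing_mx_sym :
  (forall v w, bform B (v *m killing_mx) w = bform B v (w *m killing_mx)) <-> S^T = S.
Proof.
have bE v w : bform B (v *m killing_mx) w =
    (v *m invmx E *m spin_mx S *m (w *m invmx E)^T) 0 0.
  by rewrite -bform_frame mulmxKV ?uE // /killing_mx !mulmxA.
have bE' v w : bform B v (w *m killing_mx) =
    (v *m invmx E *m (spin_mx S)^T *m (w *m invmx E)^T) 0 0.
  by rewrite -mulmxA -trmx_mul -bform_frame mulmxKV ?uE // /killing_mx !mulmxA.
split=> [symM|/eqP].
  apply/eqP; rewrite -spin_mx_sym; apply/eqP/matrixP=> i j.
  have := symM (delta_mx 0 i *m E) (delta_mx 0 j *m E).
  rewrite bE bE' !(mulmxK uE) trmx_delta -!rowE -!colE.
  by rewrite !mxE.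
by rewrite -spin_mx_sym => /eqP symM v w; rewrite bE bE' symM.
Qed.

Variables (G : topGroupType) (atlas : set (chart R G)).

Lemma gen_killing_with_cst psi : S^T = S ->
  gen_killing_with atlas br B E (fun=> killing_mx) psi.
Proof.
move=> /killing_mx_sym symM; split=> // [c _|X _ p].
  exact: smooth_on_cst.
exact: spin_nabla_killing.
Qed.

(** Constant vector fields are smooth; testing the equation on those with values in the standard
    basis determines each row of [A p], because Clifford multiplication on [psi] is injective. *)
Lemma gen_killing_withE psi A : psi != 0 ->
  gen_killing_with atlas br B E A psi -> S^T = S /\ A = fun=> killing_mx.
Proof.
move=> psi0 [_ symA eqA].
have AM p : A p = killing_mx.
  apply/row_matrixP=> i; rewrite !rowE; set v := delta_mx 0 i.
  have smv : smooth_map atlas (fun=> v) by move=> c _; exact: smooth_on_cst.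
  have := eqA _ smv p; rewrite spin_nabla_killing => /eqP.
  rewrite eq_sym -subr_eq0 /clifford -sumrB => /eqP vA.
  have : clifford E ((v *m A p - v *m killing_mx) *m invmx E *m E) psi = 0.
    rewrite mulmxKV ?uE // -[RHS]vA; apply: eq_bigr => k _.
    by rewrite -scalerBl mulmxBl mxE [X in _ + X]mxE -[Complex _ _]/((_ - _)%:C%C) rmorphB.
  move/(clifford_inj uE psi0)/(congr1 (mulmx^~ E)).
  by rewrite mulmxKV ?uE // mul0mx => /eqP; rewrite subr_eq0 => /eqP.
split; last exact/funext.
by apply/killing_mx_sym => v w; rewrite -(AM 1%g).
Qed.

Lemma gen_killing_sym psi : psi != 0 -> gen_killing atlas br B E psi -> S^T = S.
Proof. by move=> psi0 [A /(gen_killing_withE psi0)[]]. Qed.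

Lemma two_dim_gen_killing_sym : S^T = S -> two_dim_gen_killing atlas br B E.
Proof.
move=> symS; exists fullv; split; first by rewrite dimvf.
move=> psi; rewrite memvf; split=> // _.
by exists (fun=> killing_mx); exact: gen_killing_with_cst.
Qed.

(** For symmetric [S], the definition of [spin_mx] solved for [S] gives half the trace minus twice
    [spin_mx S]; and [killing_mx] is similar to [spin_mx S], with eigenvectors matched by [E]. *)
Lemma eigenvalue_killing_mx a : S^T = S ->
  eigenvalue killing_mx a = eigenvalue S (\tr S / 2 - 2 * a).
Proof.
move=> symS.
have two0 : (2 : R) != 0 by rewrite pnatr_eq0.
have spinM (M : 'M[R]_3) v : M^T = M ->
    v *m M = (\tr M / 2) *: v - 2 *: (v *m spin_mx M).
  move=> symM; rewrite /spin_mx symM -scalemxAr scalerA divff // scale1r.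
  by rewrite mulmxBr mul_mx_scalar opprB addrC subrK.
have spinS v := spinM S v symS.
apply/eigenvalueP/eigenvalueP => -[v].
  rewrite /killing_mx !mulmxA => va v0; exists (v *m invmx E).
    rewrite spinS -[_ *m spin_mx _](mulmxK uE) va scalerBl -scalemxAl scalerA.
    by [].
  by apply: contra_neq v0 => /(congr1 (mulmx^~ E)) /=; rewrite mulmxKV ?uE // mul0mx.
rewrite spinS => /eqP; rewrite scalerBl (inj_eq (addrI _)) eqr_opp -scalerA.
rewrite (inj_eq (scalerI two0)) => /eqP va v0; exists (v *m E).
  by rewrite /killing_mx !mulmxA mulmxK ?uE // va scalemxAl.
by apply: contra_neq v0 => /(congr1 (mulmx^~ (invmx E))) /=; rewrite mulmxK ?uE // mul0mx.
Qed.

Lemma num_eigenvalues_killing_mx r : S^T = S ->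
  num_eigenvalues killing_mx r <-> num_eigenvalues S r.
Proof.
move=> symS; have two0 : (2 : R) != 0 by rewrite pnatr_eq0.
set t := \tr S / 2.
have fK : cancel (fun a => t - 2 * a) (fun b => (t - b) / 2) by move=> a; field.
have gK : cancel (fun b => (t - b) / 2) (fun a => t - 2 * a) by move=> a; field.
split; first by apply: (num_eigenvalues_map fK gK) => a; exact: eigenvalue_killing_mx.
apply: (num_eigenvalues_map gK fK) => a.
by rewrite eigenvalue_killing_mx // (gK a).
Qed.

Lemma gen_killing_eigenvaluesE psi r : psi != 0 ->
  gen_killing_eigenvalues atlas br B E psi r <-> S^T = S /\ num_eigenvalues S r.
Proof.
move=> psi0; split=> [[A [/(gen_killing_withE psi0)[symS ->] /(_ 1%g)]]|[symS nS]].
  by move/(num_eigenvalues_killing_mx _ symS).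
exists (fun=> killing_mx); split; first exact: gen_killing_with_cst.
by move=> _; apply/num_eigenvalues_killing_mx.
Qed.

Lemma two_dim_gen_killing_eigenvaluesE r : S^T = S -> num_eigenvalues S r ->
  two_dim_gen_killing_eigenvalues atlas br B E r.
Proof.
move=> symS nS; split; first exact: two_dim_gen_killing_sym.
by move=> psi psi0 _; apply/gen_killing_eigenvaluesE.
Qed.

End Frame.

(** * Eigenvalues of congruent structure matrices *)

Section Bianchi.
Variable R : realType.
Implicit Types (u v w x y z q : 'rV[R]_3) (A B E L M N P Q S T : 'M[R]_3).

Lemma dot_ge0 u : 0 <= (u *m u^T) 0 0.
Proof. by rewrite mxE sumr_ge0 // => i _; rewrite !mxE -expr2 sqr_ge0. Qed.

Lemma dot_gt0 u : u != 0 -> 0 < (u *m u^T) 0 0.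
Proof.
move=> u0; rewrite lt_neqAle dot_ge0 andbT eq_sym; apply: contra u0 => uu.
apply/eqP/rowP=> k; rewrite mxE; apply/eqP.
have : \sum_i u 0 i ^+ 2 == 0.
  by move: uu; rewrite mxE; under eq_bigr => i _ do rewrite mxE -expr2.
rewrite psumr_eq0 => [/allP/(_ k)|i _]; last exact: sqr_ge0.
by rewrite mem_index_enum sqrf_eq0 => /(_ isT).
Qed.

Lemma dotC u v : (u *m v^T) 0 0 = (v *m u^T) 0 0.
Proof. by rewrite -[u in LHS]trmxK -trmx_mul [LHS]mxE. Qed.

Lemma mul_dot x u v : x *m (u^T *m v) = (x *m u^T) 0 0 *: v.
Proof. by rewrite mulmxA {1}[x *m u^T]mx11_scalar mul_scalar_mx. Qed.

Lemma eigenvalue0_rank M : (\rank M < 3)%N -> eigenvalue M 0.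
Proof.
move=> rkM; rewrite /eigenvalue /eigenspace raddf0 subr0 kermx_eq0.
by rewrite /row_free; case: eqP rkM => // ->.
Qed.

(** A further eigenvalue would be a fourth root of the characteristic polynomial, which has degree
    three. *)
Lemma num_eigenvalues_full M (s : seq R) : uniq s -> size s = 3%N ->
  (forall a, a \in s -> eigenvalue M a) -> num_eigenvalues M 3.
Proof.
move=> us szs sM; exists s; split=> // a; apply/idP/idP => [/sM //|eMa].
apply: contraTT isT => nas.
have : (size (a :: s) < size (char_poly M))%N.
  apply: max_poly_roots; first by rewrite monic_neq0 // char_poly_monic.
    rewrite /= -eigenvalue_root_char eMa.
    by apply/allP => b /sM; rewrite eigenvalue_root_char.
  by rewrite /= nas us.
by rewrite size_char_poly /= szs.
Qed.

Lemma num_eigenvalues0 : num_eigenvalues (0 : 'M[R]_3) 1.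
Proof.
exists [:: 0]; split=> // a; rewrite inE; apply/eqP/eigenvalueP => [->|[v]].
  exists (const_mx 1); first by rewrite mulmx0 scale0r.
  by apply/eqP => /rowP/(_ 0); rewrite !mxE => /eqP; rewrite oner_eq0.
by rewrite mulmx0 => /esym/eqP; rewrite scaler_eq0 => /orP[/eqP //|->].
Qed.

(** The matrix kills the orthogonal complement of [q] and scales [q] by [c * s]. For a non-zero
    eigenvalue, pairing the eigenvector equation with [q] identifies the eigenvalue. *)
Lemma num_eigenvalues_rank1 (c : R) q : c != 0 -> q != 0 ->
  num_eigenvalues (c *: (q^T *m q)) 2.
Proof.
move=> c0 q0; have qq := dot_gt0 q0; set s := (q *m q^T) 0 0 in qq.
exists [:: 0; c * s]; split=> // [|a].
  by rewrite /= inE eq_sym mulf_neq0 // gt_eqF.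
rewrite !inE; apply/idP/idP => [/orP[/eqP->|/eqP->]|].
- apply/eigenvalue0_rank/(@leq_ltn_trans 1) => //.
  apply: leq_trans (mxrank_scale _ _) _.
  exact: leq_trans (mxrankM_maxl _ _) (rank_leq_col _).
- by apply/eigenvalueP; exists q => //; rewrite -scalemxAr mul_dot scalerA.
case/eigenvalueP=> v; rewrite -scalemxAr mul_dot scalerA => va v0.
have [//|a0 /=] := eqVneq a 0.
have vq0 : (v *m q^T) 0 0 != 0.
  apply: contra_neq v0 => vq; move: va; rewrite vq mulr0 scale0r => /esym/eqP.
  by rewrite scaler_eq0 (negPf a0) => /eqP.
have : c * (v *m q^T) 0 0 * s = a * (v *m q^T) 0 0.
  have ZE k (M : 'M[R]_1) : (k *: M) 0 0 = k * M 0 0 by rewrite mxE.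
  by move/(congr1 (fun x => (x *m q^T) 0 0)): va; rewrite -!scalemxAl !ZE.
by rewrite mulrAC => /(mulIf vq0) ->.
Qed.

Lemma lagrange_identity u v :
  ((cross u v) *m (cross u v)^T) 0 0 =
  (u *m u^T) 0 0 * (v *m v^T) 0 0 - (u *m v^T) 0 0 ^+ 2.
Proof. by rewrite !mxE !sum3 !mxE /=; ring. Qed.

(* With [al = |u|] and [be = |v|], the vectors [be u + al v] and [be u - al v]
   are eigenvectors, for the eigenvalues [<u, v> + al be] and [<u, v> - al be]
   respectively. *)
Lemma num_eigenvalues_hyperbolic (c : R) u v : c != 0 -> cross u v != 0 ->
  num_eigenvalues (c *: (u^T *m v + v^T *m u)) 3.
Proof.
move=> c0 uv0.
have [s sE] : exists s, (u *m v^T) 0 0 = s by eexists.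
have := dot_gt0 uv0; rewrite lagrange_identity sE => disc.
pose al := Num.sqrt ((u *m u^T) 0 0); pose be := Num.sqrt ((v *m v^T) 0 0).
have uu : (u *m u^T) 0 0 = al ^+ 2 by rewrite sqr_sqrtr ?dot_ge0.
have vv : (v *m v^T) 0 0 = be ^+ 2 by rewrite sqr_sqrtr ?dot_ge0.
have al0 : 0 <= al by exact: sqrtr_ge0.
have be0 : 0 <= be by exact: sqrtr_ge0.
rewrite uu vv -exprMn in disc.
(* Strict Cauchy-Schwarz inequality, from Lagrange's identity; it separates the three
   eigenvalues. *)
have lt_s : `|s| < al * be.
  rewrite -(ltr_pXn2r (n := 2)) // ?nnegrE ?mulr_ge0 //.
  by rewrite real_normK ?num_real // -subr_gt0.
have [s_lo s_hi] : - (al * be) < s /\ s < al * be.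
  by move: lt_s; rewrite ltr_norml => /andP[].
have be_gt0 : 0 < be.
  by rewrite lt_neqAle be0 andbT; apply: contraTneq lt_s => <-; rewrite mulr0 -leNgt.
(* The cross product with [v] is a non-zero multiple of [cross u v], whatever [e]. *)
have v0 (e : R) : be *: u + e *: v != 0.
  apply: contra_neq uv0 => beu; apply: (scalerI (lt0r_neq0 be_gt0)).
  have -> : be *: cross u v = cross (be *: u + e *: v) v.
    by apply/rowP; apply: ord3_ind; rewrite !mxE /=; ring.
  by rewrite beu; apply/rowP; apply: ord3_ind; rewrite !mxE /=; ring.
have eig (e : R) : e ^+ 2 = al ^+ 2 ->
    (be *: u + e *: v) *m (c *: (u^T *m v + v^T *m u)) =
    (c * (s + e * be)) *: (be *: u + e *: v).
  move=> ee; have dotE w : ((be *: u + e *: v) *m w^T) 0 0 =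
      be * (u *m w^T) 0 0 + e * (v *m w^T) 0 0.
    by rewrite mulmxDl -!scalemxAl; move: (u *m _) (v *m _) => p q; rewrite !mxE.
  rewrite -scalemxAr mulmxDr !mul_dot !dotE uu vv (dotC v u) sE -ee -scalerA.
  by congr (_ *: _); apply/rowP=> i; rewrite !mxE; ring.
apply: (@num_eigenvalues_full _ [:: 0; c * (s + al * be); c * (s - al * be)]) => //.
  rewrite /= !inE !negb_or !andbT [0 == _]eq_sym [0 == _]eq_sym.
  by rewrite (inj_eq (mulfI c0)) !mulf_neq0 //; lra.
move=> a; rewrite !inE => /or3P[] /eqP->.
- apply/eigenvalue0_rank/(@leq_ltn_trans 2) => //.
  apply: leq_trans (mxrank_scale _ _) _; apply: leq_trans (mxrank_add _ _) _.
  by apply: (@leq_add _ _ 1 1); exact: leq_trans (mxrankM_maxl _ _) (rank_leq_col _).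
- by apply/eigenvalueP; exists (be *: u + al *: v); rewrite ?eig ?v0.
- apply/eigenvalueP; exists (be *: u + (- al) *: v); rewrite ?eig ?v0 ?sqrrN //.
  by rewrite mulNr.
Qed.

(** The two changes of basis, by [T] to Bianchi's basis and by [E] to the frame, compose to one
    congruence up to a non-zero factor. *)
Lemma bianchi_frame_mx b (o : bool) B E T : T \in unitmx -> oriented_frame o B E ->
  exists (c : R) Q, [/\ c != 0, Q \in unitmx &
    frame_mx (\det T *: (invmx T^T *m bianchi_mx b *m invmx T)) E =
    c *: (Q^T *m bianchi_mx b *m Q)].
Proof.
move=> uT /frame_gram/frame_unit uE.
exists (\det E * \det T), (invmx T *m invmx E); split.
- by rewrite mulf_neq0 // -?unitfE -?unitmxE.
- by rewrite unitmx_mul !unitmx_inv uT.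
rewrite /frame_mx -scalemxAr -scalemxAl scalerA trmx_mul !trmx_inv.
by rewrite !mulmxA.
Qed.

Lemma congruence_sym (c : R) Q M : c != 0 -> Q \in unitmx ->
  ((c *: (Q^T *m M *m Q))^T == c *: (Q^T *m M *m Q)) = (M^T == M).
Proof.
move=> c0 uQ; rewrite linearZ /= (inj_eq (scalerI c0)) !trmx_mul trmxK mulmxA.
by rewrite (inj_eq (can_inj (mulmxK uQ))) (inj_eq (can_inj (mulKmx _))) ?unitmx_tr.
Qed.

End Bianchi.

(** * Spectral theorem and Krylov matrices *)

(** Unitary diagonalisation reduces the claim to the diagonal entries, which are real eigenvalues
    and therefore roots of [p]. *)
Lemma hermitian_annihilator (C : numClosedFieldType) n (A : 'M[C]_n.+1) (p : {poly C}) :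
  A \is hermsymmx ->
  (forall a, a \is Num.real -> eigenvalue A a -> root p a) -> horner_mx A p = 0.
Proof.
move=> Aherm rootp; have := hermitian_spectral_diag_real Aherm.
have /hermitian_normalmx/orthomx_spectralP := Aherm.
have := spectral_unit A.
move: (spectralmx A) (spectral_diag A) => P d uP AE /mxOverP dreal.
rewrite AE horner_mx_uconjC // horner_mx_diag.
suff -> : map_mx (horner p) d = 0 by rewrite raddf0 mulmx0 mul0mx.
apply/rowP=> i; rewrite !mxE; apply/rootP/rootp => //.
apply/eigenvalueP; exists (row i P).
  by rewrite -row_mul {1}AE !mulmxA mulmxV // mul1mx row_mul row_diag_mx -scalemxAl -rowE.
apply: contraTneq uP => Pi0; rewrite -row_free_unit; apply/negP => /row_freeP[Q PQ].
have := congr1 (row i) PQ; rewrite row_mul Pi0 mul0mx => /rowP/(_ i).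
by rewrite !mxE eqxx => /esym/eqP; rewrite oner_eq0.
Qed.

(** Over the complex numbers [S] is Hermitian, and the real eigenvalues found there are already
    eigenvalues of [S] over [R]. *)
Lemma sym_annihilator (R : realType) n (S : 'M[R]_n.+1) (s : seq R) : S^T = S ->
  (forall a, eigenvalue S a -> a \in s) ->
  horner_mx S (\prod_(a <- s) ('X - a%:P)) = 0.
Proof.
move=> symS sP; apply: (map_mx_inj (f := real_complex R)).
rewrite map_horner_mx map_mx0; apply: hermitian_annihilator => [|_ /complex_realP[a ->]].
  apply: realsym_hermsym; last by apply/mxOverP => i j; rewrite mxE complex_real.
  by apply/is_hermitianmxP/matrixP=> i j; rewrite expr0 scale1r !mxE -[in LHS]symS mxE.
rewrite eigenvalue_map => /sP sa; rewrite rootE horner_map /=.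
have /rootP -> : root (\prod_(a <- s) ('X - a%:P)) a by rewrite root_prod_XsubC.
by rewrite rmorph0.
Qed.

Section Krylov.
Variables (F : fieldType) (n : nat).
Implicit Types (v : 'rV[F]_n.+1) (M P : 'M[F]_n.+1).

Definition krylov v M : 'M[F]_n.+1 := \matrix_i (v *m M ^+ i).

(** The coefficients of [p] are a linear relation between the rows of the Krylov matrix. *)
Lemma krylov_det0 v M (p : {poly F}) : p != 0 -> (size p <= n.+1)%N ->
  horner_mx M p = 0 -> \det (krylov v M) = 0.
Proof.
move=> p0 szp pM; apply/eqP/det0P; exists (\row_(i < n.+1) p`_i).
  apply: contra_neq p0 => /rowP pz; apply/polyP => i; rewrite coef0.
  have [ltin|leni] := ltnP i n.+1; first by have := pz (Ordinal ltin); rewrite !mxE.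
  by rewrite nth_default // (leq_trans szp).
have <- : v *m horner_mx M p = 0 by rewrite pM mulmx0.
have -> : p = \poly_(i < n.+1) p`_i.
  apply/polyP => i; rewrite coef_poly; case: ltnP => // leni.
  by rewrite nth_default // (leq_trans szp).
rewrite poly_def rmorph_sum /= mulmx_sumr mulmx_sum_row; apply: eq_bigr => i _.
rewrite horner_mxZ rmorphXn /= horner_mx_X -scalemxAr rowK mxE -poly_def.
by rewrite coef_poly ltn_ord.
Qed.

Lemma krylov_scale v M (a : F) : a != 0 ->
  \det (krylov v (a *: M)) = 0 -> \det (krylov v M) = 0.
Proof.
move=> a0.
have -> : krylov v (a *: M) = diag_mx (\row_i a ^+ i) *m krylov v M.
  apply/row_matrixP=> i; rewrite rowK row_mul row_diag_mx exprZn.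
  by rewrite -scalemxAr -scalemxAl -rowE rowK mxE.
rewrite det_mulmx det_diag => /eqP; rewrite mulf_eq0 => /orP[|/eqP //].
by rewrite prodf_seq_eq0 => /hasP[i _]; rewrite mxE expf_eq0 (negPf a0) andbF.
Qed.

Lemma krylov_conj v M P : P \in unitmx ->
  krylov v (P *m M *m invmx P) = krylov (v *m P) M *m invmx P.
Proof.
move=> uP; apply/row_matrixP=> i; rewrite row_mul !rowK; elim: (i : nat) => [|k IHk].
  by rewrite !expr0 !mulmx1 mulmxK.
by rewrite !exprSr -!mulmxE !mulmxA IHk mulmxKV.
Qed.

End Krylov.

(** * Null sets of polynomials *)

(* Being measurable and polynomial in each variable separately is all that the
   Fubini argument uses, so multivariate polynomials are never needed. *)
Section SeparatelyPolynomial.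
Variable R : realType.

Definition polyfun : set (R -> R) :=
  [set f | exists p : {poly R}, forall x, f x = p.[x]].

(** Adjoins one real variable on the left, following the nesting of the product measure in
    [null_metrics]. *)
Definition lift_polyfun d (T : measurableType d) (C : set (T -> R)) :
    set (measurableTypeR R * T -> R) :=
  [set f | [/\ measurable_fun setT f, forall t, polyfun (fun x => f (x, t))
             & forall x, C (fun t => f (x, t))]].

Definition ring_closed_fun (T : Type) (C : set (T -> R)) : Prop :=
  [/\ forall a, C (fun=> a), forall f g, C f -> C g -> C (fun t => f t + g t)
    & forall f g, C f -> C g -> C (fun t => f t * g t)].

Definition zeros_negligible d (T : measurableType d) (m : set T -> \bar R)
    (C : set (T -> R)) : Prop :=
  forall f, C f -> (exists t, f t != 0) -> m.-negligible [set t | f t = 0].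

Lemma polyfun_closed : ring_closed_fun polyfun.
Proof.
split=> [a|f g [p fp] [q gq]|f g [p fp] [q gq]].
- by exists a%:P => x; rewrite hornerC.
- by exists (p + q) => x; rewrite hornerD fp gq.
- by exists (p * q) => x; rewrite hornerM fp gq.
Qed.

Lemma lift_polyfun_closed d (T : measurableType d) (C : set (T -> R)) :
  ring_closed_fun C -> ring_closed_fun (lift_polyfun C).
Proof.
move=> [Ccst CD CM]; have [Pcst PD PM] := polyfun_closed.
split=> [a|f g [mf pf Cf] [mg pg Cg]|f g [mf pf Cf] [mg pg Cg]].
- by split=> // t; exact: Pcst.
- by split=> [|t|x]; [exact: measurable_funD | exact: PD | exact: CD].
- by split=> [|t|x]; [exact: measurable_funM | exact: PM | exact: CM].
Qed.

Lemma lift_polyfun_fst d (T : measurableType d) (C : set (T -> R)) :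
  ring_closed_fun C -> lift_polyfun C fst.
Proof.
move=> [Ccst _ _]; split=> [|t|x]; [exact: measurable_fst | | exact: Ccst].
by exists 'X => x; rewrite hornerX.
Qed.

Lemma lift_polyfun_snd d (T : measurableType d) (C : set (T -> R)) g :
  measurable_fun setT g -> C g -> lift_polyfun C (g \o snd).
Proof.
move=> mg Cg; split=> [|t|x] //=; first exact: measurableT_comp.
by have [Pcst _ _] := polyfun_closed; exact: Pcst.
Qed.

Lemma polyfun_zeros (f : R -> R) : polyfun f -> (exists x, f x != 0) ->
  finite_set [set x | f x = 0].
Proof.
move=> [p fp] [x0 fx0].
have p0 : p != 0 by apply: contra_neq fx0 => pz; rewrite fp pz horner0.
apply: contrapT => /(infinite_set_fset (size p))[B Bz].
apply/negP; rewrite -ltnNge; apply: max_poly_roots => //; last exact: finmap.fset_uniq.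
by apply/allP => x xB; rewrite rootE -fp; apply/eqP; exact: Bz.
Qed.

Lemma polyfun_zeros_negligible : zeros_negligible (@lebesgue_measure R) polyfun.
Proof.
move=> f pf nzf; have /finite_set_countable cz := polyfun_zeros pf nzf.
exists [set x | f x = 0]; split=> //; last exact: countable_lebesgue_measure0.
exact: countable_measurable.
Qed.

Section LebesgueProduct.
Context d (T : measurableType d) (m : {sigma_finite_measure set T -> \bar R}).

(* The library's product measure is only inferred to be sigma-finite when it is a
   product of subprobabilities. *)
Definition lebesgue_prod := (@lebesgue_measure R \x m)%E.

HB.instance Definition _ := Measure.on lebesgue_prod.

Let lebesgue_prod_sigma_finite : sigma_finite setT lebesgue_prod.
Proof.
have /sigma_finiteP[F [FT ndF Ffin]] := sigma_finiteT (@lebesgue_measure R).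
have /sigma_finiteP[H [HT ndH Hfin]] := sigma_finiteT m.
exists (fun n => F n `*` H n) => [|n].
  apply/esym/seteqP; split=> // -[x t] _.
  have [i _ Fx] : (\bigcup_i F i) x by rewrite -FT.
  have [j _ Ht] : (\bigcup_j H j) t by rewrite -HT.
  (* Both exhausting sequences increase, so the larger index serves both coordinates. *)
  exists (maxn i j) => //; split.
    by move/subsetPset: (ndF _ _ (leq_maxl i j)); exact.
  by move/subsetPset: (ndH _ _ (leq_maxr i j)); exact.
have [mF Foo] := Ffin n; have [mH Hoo] := Hfin n.
split; first exact: measurableX.
rewrite /lebesgue_prod product_measure1E //.
by rewrite lte_mul_pinfty // ge0_fin_numE.
Qed.

HB.instance Definition _ :=
  Measure_isSigmaFinite.Build _ _ _ lebesgue_prod lebesgue_prod_sigma_finite.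

(** Outside the finitely many roots of the non-zero polynomial [f (_, t0)], the slice of [f] at [x]
    is non-zero at [t0], so its zero set is null; Fubini integrates these slices to zero. *)
Lemma lift_zeros_negligible (C : set (T -> R)) :
  zeros_negligible m C -> zeros_negligible lebesgue_prod (lift_polyfun C).
Proof.
move=> mC f [mf pf Cf] [[x0 t0] f0].
have mZ : measurable [set z | f z = 0].
  by rewrite -[X in measurable X]setTI; exact: (mf measurableT [set 0]).
exists [set z | f z = 0]; split=> //.
have negl : (@lebesgue_measure R).-negligible [set x | f (x, t0) = 0].
  by apply: polyfun_zeros_negligible; [exact: pf | exists x0].
rewrite /lebesgue_prod /product_measure1 -(integral0 (@lebesgue_measure R) setT).
apply: ge0_ae_eq_integral => //; first exact: measurable_fun_xsection.
apply: negligibleS negl => x /=; apply: contra_notP => /eqP fx0 _.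
apply: measure_negligible; first exact: measurable_xsection.
rewrite (_ : xsection _ x = [set t | f (x, t) = 0]); last first.
  by apply/seteqP; split=> t /=; rewrite /xsection /= inE.
by apply: mC (Cf x) _; exists t0.
Qed.

End LebesgueProduct.

End SeparatelyPolynomial.

(** * Determinants and Krylov matrices over a ring of functions *)

Section ClosedMatrix.
Variables (R : realType) (T : Type) (C : set (T -> R)).
Hypothesis clC : ring_closed_fun C.

Lemma ring_closed_sum (I : Type) (r : seq I) (F : I -> T -> R) :
  (forall i, C (F i)) -> C (fun t => \sum_(i <- r) F i t).
Proof.
have [Ccst CD _] := clC => CF; elim: r => [|i r IHr].
  by under eq_fun do rewrite big_nil; exact: Ccst.
by under eq_fun do rewrite big_cons; exact: CD.
Qed.

Lemma ring_closed_prod (I : Type) (r : seq I) (F : I -> T -> R) :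
  (forall i, C (F i)) -> C (fun t => \prod_(i <- r) F i t).
Proof.
have [Ccst _ CM] := clC => CF; elim: r => [|i r IHr].
  by under eq_fun do rewrite big_nil; exact: Ccst.
by under eq_fun do rewrite big_cons; exact: CM.
Qed.

Lemma ring_closed_mulmx m n p (A : T -> 'M[R]_(m, n)) (B : T -> 'M[R]_(n, p)) :
  (forall i j, C (fun t => A t i j)) -> (forall i j, C (fun t => B t i j)) ->
  forall i j, C (fun t => (A t *m B t) i j).
Proof.
have [_ _ CM] := clC => CA CB i j; under eq_fun do rewrite mxE.
by apply: ring_closed_sum => k; exact: CM.
Qed.

Lemma ring_closed_det n (A : T -> 'M[R]_n) :
  (forall i j, C (fun t => A t i j)) -> C (fun t => \det (A t)).
Proof.
have [Ccst _ CM] := clC => CA; rewrite /determinant.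
apply: ring_closed_sum => s; apply: CM; first exact: Ccst.
exact: ring_closed_prod.
Qed.

Lemma ring_closed_det_krylov n (v : 'rV[R]_n.+1) (M : T -> 'M[R]_n.+1) :
  (forall i j, C (fun t => M t i j)) -> C (fun t => \det (krylov v (M t))).
Proof.
have [Ccst _ _] := clC => CM; apply: ring_closed_det => i j.
rewrite (_ : (fun t => _) = (fun t => (v *m M t ^+ i) 0 j)); last first.
  by apply/funext => t; rewrite mxE.
apply: (ring_closed_mulmx (A := fun=> v)) => [*|k l]; first exact: Ccst.
elim: (nat_of_ord i) k l => [|m IHm] k l; first exact: Ccst.
rewrite (_ : (fun t => _) = (fun t => (M t *m M t ^+ m) k l)); last first.
  by apply/funext => t; rewrite exprS.
exact: ring_closed_mulmx.
Qed.

End ClosedMatrix.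

(** * Null sets in the space of symmetric matrices *)

Section NullMetrics.
Variable R : realType.
Let C1 : set (measurableTypeR R -> R) := @polyfun R.
Let C2 := lift_polyfun C1.
Let C3 := lift_polyfun C2.
Let C4 := lift_polyfun C3.
Let C5 := lift_polyfun C4.
Let C6 := lift_polyfun C5.

Let clC6 : ring_closed_fun C6.
Proof. by do 5!apply: lift_polyfun_closed; exact: polyfun_closed. Qed.

Lemma sym_mx_polyfun i j : C6 (fun b => @sym_mx R b i j).
Proof.
have cl1 : ring_closed_fun C1 by exact: polyfun_closed.
have cl2 := lift_polyfun_closed cl1; have cl3 := lift_polyfun_closed cl2.
have cl4 := lift_polyfun_closed cl3; have cl5 := lift_polyfun_closed cl4.
(* In [pkj], the first digit is the number of variables and the second the coordinate projected to;
   each [up] adds a variable on the left and shifts both digits by one. *)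
have p21 : C2 fst by exact: lift_polyfun_fst.
have p22 : C2 snd.
  apply: (@lift_polyfun_snd _ _ _ _ id); first exact: measurable_id.
  by exists 'X => x; rewrite hornerX.
have up d (T : measurableType d) (C : set (T -> R)) g :
    lift_polyfun C g -> lift_polyfun (lift_polyfun C) (g \o snd).
  by move=> Cg; apply: lift_polyfun_snd => //; case: Cg.
have p31 : C3 fst by exact: lift_polyfun_fst.
have p32 := up _ _ _ _ p21; have p33 := up _ _ _ _ p22.
have p41 : C4 fst by exact: lift_polyfun_fst.
have p42 := up _ _ _ _ p31; have p43 := up _ _ _ _ p32; have p44 := up _ _ _ _ p33.
have p51 : C5 fst by exact: lift_polyfun_fst.
have p52 := up _ _ _ _ p41; have p53 := up _ _ _ _ p42.
have p54 := up _ _ _ _ p43; have p55 := up _ _ _ _ p44.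
have p61 : C6 fst by exact: lift_polyfun_fst.
have p62 := up _ _ _ _ p51; have p63 := up _ _ _ _ p52; have p64 := up _ _ _ _ p53.
have p65 := up _ _ _ _ p54; have p66 := up _ _ _ _ p55.
have eqC (f g : _ -> R) : C6 f -> (forall b11 b12 b13 b22 b23 b33,
    f (b11, (b12, (b13, (b22, (b23, b33))))) =
    g (b11, (b12, (b13, (b22, (b23, b33)))))) -> C6 g.
  by move=> Cf fg; rewrite (_ : g = f) //; apply/funext => -[? [? [? [? [? ?]]]]].
move: i j; apply: ord3_ind; apply: ord3_ind;
  [apply: eqC p61 _|apply: eqC p62 _|apply: eqC p63 _
  |apply: eqC p62 _|apply: eqC p64 _|apply: eqC p65 _
  |apply: eqC p63 _|apply: eqC p65 _|apply: eqC p66 _] => *; by rewrite mxE.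
Qed.

Lemma null_metricsS (A B : set 'M[R]_3) : A `<=` B -> null_metrics B -> null_metrics A.
Proof. by move=> AB [X [mX X0 BX]]; exists X; split=> // b /AB; exact: BX. Qed.

Lemma krylov_null (v : 'rV[R]_3) (N : 'M[R]_3) :
  (exists b, \det (krylov v (N *m sym_mx b)) != 0) ->
  null_metrics [set B | \det (krylov v (N *m B)) = 0].
Proof.
have [Ccst _ _] := clC6.
have z1 : zeros_negligible (@lebesgue_measure R) C1 := @polyfun_zeros_negligible R.
have z6 := lift_zeros_negligible (lift_zeros_negligible (lift_zeros_negligible
  (lift_zeros_negligible (lift_zeros_negligible z1)))).
apply: z6.
apply: (ring_closed_det_krylov clC6); apply: (ring_closed_mulmx clC6) => i j.
  exact: Ccst.
exact: sym_mx_polyfun.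
Qed.

Lemma sym_mx_surj (B : 'M[R]_3) : B^T = B -> exists b, sym_mx b = B.
Proof.
move=> symB; have BE i j : B i j = B j i by rewrite -[in LHS]symB mxE.
exists (B 0 0, (B 0 1, (B 0 2, (B 1 1, (B 1 2, B 2 2))))).
by apply/matrixP; apply: ord3_ind; apply: ord3_ind; rewrite mxE /=.
Qed.

End NullMetrics.

(** * Bianchi classes *)

Section BianchiClasses.
Variable R : realType.
Implicit Types (u v w : 'rV[R]_3) (B E M N P Q S T : 'M[R]_3).

Lemma krylov3 w M : krylov w M = rows3 w (w *m M) (w *m M *m M).
Proof.
apply/row_matrixP; apply: ord3_ind; apply/rowP=> j; rewrite !rowK /=.
all: by rewrite ?modn_small //= ?addn1 ?expr0 ?expr1 ?expr2 -?mulmxE ?mulmx1 ?mulmxA.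
Qed.

(** The product of the linear factors at the distinct eigenvalues annihilates [S] and has degree
    [r], at most two. *)
Lemma krylov_sym_det0 S r w : S^T = S -> (r < 3)%N -> num_eigenvalues S r ->
  \det (krylov w S) = 0.
Proof.
move=> symS lt_r3 [s [_ szs sE]].
apply: (@krylov_det0 _ _ _ _ (\prod_(a <- s) ('X - a%:P))).
- exact/monic_neq0/monic_prod_XsubC.
- by rewrite size_prod_XsubC szs.
- by apply: sym_annihilator => // a; rewrite sE.
Qed.

(** Orthonormality gives [B = invmx E *m invmx E^T], so [\det E *: (N *m B)] is the conjugate of
    [frame_mx N E] by [E^T]; the Krylov vector [v] becomes [v *m E^T]. *)
Lemma krylov_frame_det0 N B E v : E *m B *m E^T = 1%:M ->
  (forall w, \det (krylov w (frame_mx N E)) = 0) -> \det (krylov v (N *m B)) = 0.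
Proof.
move=> gramE detS; have uE := frame_unit gramE.
have dE : \det E != 0 by rewrite -unitfE -unitmxE.
apply: (krylov_scale dE).
have -> : \det E *: (N *m B) = E^T *m frame_mx N E *m invmx E^T.
  have BE : B = invmx E *m invmx E^T.
    have uEt : E^T \in unitmx by rewrite unitmx_tr.
    by rewrite -[LHS](mulKmx uE) -[E *m B](mulmxK uEt) gramE mul1mx.
  by rewrite /frame_mx {1}BE -scalemxAr -scalemxAl !mulmxA mulmxV ?unitmx_tr // mul1mx.
by rewrite krylov_conj ?unitmx_tr // det_mulmx detS mul0r.
Qed.

(** Carries a witness for the standard brackets to the given basis: with the matrix [T *m D *m T^T],
    the product to be tested is [\det T] times a conjugate of [bianchi_mx b *m D]. *)
Lemma bianchi_nonvanishing b T : T \in unitmx ->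
  \det (krylov (vec3 1 1 2) (bianchi_mx b *m diag_mx (vec3 1 2 3))) != 0 ->
  exists v c, \det (krylov v
    (\det T *: (invmx T^T *m bianchi_mx b *m invmx T) *m sym_mx c)) != 0.
Proof.
move=> uT; set D := diag_mx _; set w := vec3 _ _ _ => nz.
have uTt : T^T \in unitmx by rewrite unitmx_tr.
have [c cE] : exists c, sym_mx c = T *m D *m T^T.
  by apply: sym_mx_surj; rewrite !trmx_mul trmxK tr_diag_mx mulmxA.
exists (w *m T^T), c; rewrite cE.
have dT : \det T != 0 by rewrite -unitfE -unitmxE.
rewrite -scalemxAl; apply: contra_neq nz => /(krylov_scale dT).
have -> : invmx T^T *m bianchi_mx b *m invmx T *m (T *m D *m T^T) =
    invmx T^T *m (bianchi_mx b *m D) *m invmx (invmx T^T).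
  by rewrite invmxK !mulmxA mulmxKV.
rewrite krylov_conj ?unitmx_inv // mulmxK // det_mulmx invmxK det_tr => /eqP.
by rewrite mulf_eq0 (negPf dT) orbF => /eqP.
Qed.

(** The symmetric entries of the table are exactly the unimodular algebras. *)
Lemma bianchi_mx_sym b :
  (bianchi_mx b)^T == bianchi_mx b =
  match b with
  | BianIII | BianIV | BianV => false
  | BianVI x => x == -1 :> R
  | BianVII y => y == 0
  | _ => true
  end.
Proof.
have F2 (M : 'M[R]_3) (i j : 'I_3) : M i j != M j i -> (M^T == M) = false.
  by move=> Mij; apply/eqP => /matrixP/(_ j i); rewrite mxE; apply/eqP.
have T2 (M : 'M[R]_3) :
    M 0 1 = M 1 0 -> M 0 2 = M 2 0 -> M 1 2 = M 2 1 -> (M^T == M) = true.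
  move=> M01 M02 M12; apply/eqP/matrixP; apply: ord3_ind; apply: ord3_ind; by rewrite mxE.
case: b => [||||| x | y ||] /=.
- by rewrite trmx0 eqxx.
- by apply: T2; rewrite !mxE /= ?mxE.
- by apply: (F2 _ 0 2); rewrite !mxE /= ?mxE /= eq_sym oner_eq0.
- by apply: (F2 _ 0 1); rewrite !mxE /= ?mxE /=; apply/eqP => ?; lra.
- by apply: (F2 _ 0 1); rewrite !mxE /= ?mxE /=; apply/eqP => ?; lra.
- have [->|nx] := eqVneq x (-1); first by apply: T2; rewrite !mxE /= ?mxE /= ?oppr0.
  by apply: (F2 _ 0 1); rewrite !mxE /= ?mxE.
- have [->|ny] := eqVneq y 0; first by apply: T2; rewrite !mxE /= ?mxE /= ?oppr0.
  by apply: (F2 _ 0 1); rewrite !mxE /= ?mxE /=; apply: contra_neq ny => ?; lra.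
- by apply: T2; rewrite !mxE /= ?mxE /= ?oppr0.
- by apply: T2; rewrite !mxE /= ?mxE /= ?oppr0.
Qed.

(** By [crossM] on the first two basis vectors, [Q^T] maps this cross product to [\det Q] times the
    third. *)
Lemma cross_rows_neq0 Q : Q \in unitmx -> cross (row 0 Q) (row 1 Q) != 0.
Proof.
move=> uQ; have dQ : \det Q != 0 by rewrite -unitfE -unitmxE.
apply: contra_neq dQ => cQ.
have := crossM (delta_mx 0 0) (delta_mx 0 1) Q; rewrite -!rowE cQ mul0mx.
by move=> /rowP/(_ 2); rewrite !mxE /= ?mxE /=; lra.
Qed.

Lemma num_eigenvalues_II (c : R) Q : c != 0 -> Q \in unitmx ->
  num_eigenvalues (c *: (Q^T *m bianchi_mx BianII *m Q)) 2.
Proof.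
move=> c0 uQ.
have -> : Q^T *m bianchi_mx BianII *m Q = (row 0 Q)^T *m row 0 Q.
  by apply/matrixP=> i j; rewrite !(mxE, sum3, big_ord1) /= ?mxE /=; ring.
apply: num_eigenvalues_rank1 => //; apply: contra_neq (cross_rows_neq0 uQ) => ->.
by apply/rowP; apply: ord3_ind; rewrite !mxE /=; ring.
Qed.

Lemma num_eigenvalues_VI (c : R) Q : c != 0 -> Q \in unitmx ->
  num_eigenvalues (c *: (Q^T *m bianchi_mx (BianVI (-1)) *m Q)) 3.
Proof.
move=> c0 uQ.
(* The only non-zero entries of this structure matrix are the two equal to -1 that couple the first
   two basis vectors. *)
have -> : c *: (Q^T *m bianchi_mx (BianVI (-1)) *m Q) =
    - c *: ((row 0 Q)^T *m row 1 Q + (row 1 Q)^T *m row 0 Q).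
  by apply/matrixP=> i j; rewrite !(mxE, sum3, big_ord1) /= ?mxE /=; ring.
by apply: num_eigenvalues_hyperbolic; rewrite ?oppr_eq0 ?cross_rows_neq0.
Qed.

(** The three products have simple spectra, namely 0, 1, 2 for VII_0, then -4 and the two square
    roots of 3 for VIII, then 1, 2, 3 for IX; [vec3 1 1 2] is a cyclic vector for each. *)
Lemma krylov_VII_VIII_IX b : [\/ b = BianVII 0, b = BianVIII | b = BianIX] ->
  \det (krylov (vec3 1 1 2) (bianchi_mx b *m diag_mx (vec3 1 2 3))) != 0 :> R.
Proof.
set w := vec3 1 1 2.
have K r s (a : R) M : w *m M = r -> r *m M = s -> \det (rows3 w r s) = a -> a != 0 ->
    \det (krylov w M) != 0 by move=> <- <- <-; rewrite krylov3.
case=> ->.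
- apply: (K (vec3 1 2 0) (vec3 1 4 0) 4); last by rewrite pnatr_eq0.
  + by apply/rowP; apply: ord3_ind; rewrite mul_mx_diag !(mxE, sum3) /= ?mxE /=; ring.
  + by apply/rowP; apply: ord3_ind; rewrite mul_mx_diag !(mxE, sum3) /= ?mxE /=; ring.
  + by rewrite det3 !mxE /= ?mxE /=; ring.
- apply: (K (vec3 2 (- 4) 3) (vec3 3 16 6) 13); last by rewrite pnatr_eq0.
  + by apply/rowP; apply: ord3_ind; rewrite mul_mx_diag !(mxE, sum3) /= ?mxE /=; ring.
  + by apply/rowP; apply: ord3_ind; rewrite mul_mx_diag !(mxE, sum3) /= ?mxE /=; ring.
  + by rewrite det3 !mxE /= ?mxE /=; ring.
- apply: (K (vec3 1 2 6) (vec3 1 4 18) 4); last by rewrite pnatr_eq0.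
  + by apply/rowP; apply: ord3_ind; rewrite mul_mx_diag !(mxE, sum3) /= ?mxE /=; ring.
  + by apply/rowP; apply: ord3_ind; rewrite mul_mx_diag !(mxE, sum3) /= ?mxE /=; ring.
  + by rewrite det3 !mxE /= ?mxE /=; ring.
Qed.

End BianchiClasses.

Theorem theorem4p2 (R : realType) (G : topGroupType)
    (atlas : set (chart R G)) (G_lie : is_lie_group atlas)
    (G_connected : connected [set: G])
    (c : chart R G) (atlas_c : atlas c) (c_one : dom c 1%g)
    (o : bool) :
  let g := lie_bracket c in
  let is_bian b := lie_isom g (bianchi_bracket b) in
  [/\ is_bian BianI ->
        forall B E, inner_product B -> oriented_frame o B E ->
          two_dim_gen_killing_eigenvalues atlas g B E 1 /\
          (forall psi, gen_killing atlas g B E psi -> parallel g B E psi),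
      is_bian BianII ->
        forall B E, inner_product B -> oriented_frame o B E ->
          two_dim_gen_killing_eigenvalues atlas g B E 2,
      [\/ is_bian BianIII, is_bian BianIV, is_bian BianV
        | (exists x : R, 0 < `|x| < 1 /\ is_bian (BianVI x)) \/
          (exists y : R, 0 < y /\ is_bian (BianVII y))] ->
        forall B E, inner_product B -> oriented_frame o B E ->
          forall psi, gen_killing atlas g B E psi -> psi = 0,
      is_bian (BianVI (-1)) ->
        forall B E, inner_product B -> oriented_frame o B E ->
          two_dim_gen_killing_eigenvalues atlas g B E 3
    & [\/ is_bian (BianVII 0), is_bian BianVIII | is_bian BianIX] ->
        (forall B E, inner_product B -> oriented_frame o B E ->
          two_dim_gen_killing atlas g B E) /\
        null_metrics [set B | inner_product B /\
          exists (E : 'M[R]_3) (psi : spinor R) (r : nat), [/\ oriented_frame o B E, psi != 0, (r < 3)%N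
            & gen_killing_eigenvalues atlas g B E psi r]]].
Proof.
move=> g is_bian; split.
- move=> /lie_isom_bianchi[T uT gE] B E _ fE.
  have gramE := frame_gram fE.
  have S0 : frame_mx (\det T *: (invmx T^T *m bianchi_mx BianI *m invmx T)) E = 0.
    by rewrite /frame_mx /= mulmx0 mul0mx scaler0 mulmx0 mul0mx scaler0.
  split.
    apply: (two_dim_gen_killing_eigenvaluesE gE gramE); rewrite S0 ?trmx0 //.
    exact: num_eigenvalues0.
  move=> psi _ X; rewrite (spin_nabla_killing gE gramE) /killing_mx S0.
  rewrite /spin_mx mxtrace0 mul0r raddf0 trmx0 subr0 scaler0 mulmx0 mul0mx mulmx0.
  by rewrite /clifford mul0mx big1 // => k _; rewrite mxE scale0r.
- move=> /lie_isom_bianchi[T uT gE] B E _ fE.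
  have [c1 [Q [c10 uQ SE]]] := bianchi_frame_mx BianII uT fE.
  apply: (two_dim_gen_killing_eigenvaluesE gE (frame_gram fE)); rewrite SE.
    by apply/eqP; rewrite congruence_sym // bianchi_mx_sym.
  exact: num_eigenvalues_II.
- move=> nonuni B E _ fE psi kpsi; apply/eqP; apply: contraT => psi0.
  (* A non-zero generalised Killing spinor forces a symmetric frame matrix, and congruence carries
     the symmetry back to [bianchi_mx b]. *)
  suff [b [bb nsym]] : exists b, is_bian b /\ ((bianchi_mx b)^T == bianchi_mx b) = false.
    have [T uT gE] := lie_isom_bianchi bb.
    have [c1 [Q [c10 uQ SE]]] := bianchi_frame_mx b uT fE.
    have /eqP := gen_killing_sym gE (frame_gram fE) psi0 kpsi.
    by rewrite SE congruence_sym // nsym.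
  case: nonuni => [bb|bb|bb|[[x [/andP[x0 x1] bb]]|[y [y0 bb]]]].
  + by exists BianIII; rewrite bianchi_mx_sym.
  + by exists BianIV; rewrite bianchi_mx_sym.
  + by exists BianV; rewrite bianchi_mx_sym.
  + exists (BianVI x); rewrite bianchi_mx_sym; split=> //.
    (* The bound on the absolute value excludes the unimodular parameter -1. *)
    by apply: contraTF x1 => /eqP->; rewrite normrN1 ltxx.
  + by exists (BianVII y); rewrite bianchi_mx_sym gt_eqF.
- move=> /lie_isom_bianchi[T uT gE] B E _ fE.
  have [c1 [Q [c10 uQ SE]]] := bianchi_frame_mx (BianVI (-1)) uT fE.
  apply: (two_dim_gen_killing_eigenvaluesE gE (frame_gram fE)); rewrite SE.
    by apply/eqP; rewrite congruence_sym // bianchi_mx_sym eqxx.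
  exact: num_eigenvalues_VI.
- move=> uni.
  have [b [bb eb]] : exists b, is_bian b /\ [\/ b = BianVII 0, b = BianVIII | b = BianIX].
    by case: uni => bb; [exists (BianVII 0)|exists BianVIII|exists BianIX];
      split=> //; [constructor 1|constructor 2|constructor 3].
  have [T uT gE] := lie_isom_bianchi bb; split.
    move=> B E _ fE; have [c1 [Q [c10 uQ SE]]] := bianchi_frame_mx b uT fE.
    apply: (two_dim_gen_killing_sym gE (frame_gram fE)); rewrite SE.
    apply/eqP; rewrite congruence_sym // bianchi_mx_sym.
    by case: eb => -> //; rewrite eqxx.
  have [v nz] := bianchi_nonvanishing uT (krylov_VII_VIII_IX eb).
  (* The vector [v] is fixed before the metric, so all exceptional metrics lie in the zero set of
     one Krylov determinant. *)
  apply: null_metricsS (krylov_null nz) => M [_ [E [psi [r [fE psi0 r3 kr]]]]].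
  have gramE := frame_gram fE.
  have [symS nS] := (gen_killing_eigenvaluesE gE gramE atlas r psi0).1 kr.
  apply: (krylov_frame_det0 _ gramE) => w.
  exact: krylov_sym_det0 nS.
Qed.
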